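(* Let $G$ be a block graph without isolated vertices and let $\mathbb{K}$ be a field. Then the ideal $I(\overline{\mathcal{C}_r(G)})$ has a linear resolution for all integers $r\ge2$.
   Context: Graphs are finite and simple. A block graph is a graph in which every block (maximal $2$-connected subgraph) is a clique. For $r\ge1$, $\mathcal{C}_r(G)$ is the $(r+1)$-uniform clutter on $V(G)$ whose edges are the sets $S\subseteq V(G)$ with $|S|=r+1$ and induced subgraph $G[S]$ connected; $\overline{\mathcal{C}_r(G)}$ is the clutter on $V(G)$ whose edges are the $(r+1)$-subsets of $V(G)$ that are not edges of $\mathcal{C}_r(G)$. For a clutter $\mathcal{C}$, $I(\mathcal{C})$ is the ideal generated by the monomials $\prod_{x\in e}x$, $e\in E(\mathcal{C})$, in the polynomial ring over $\mathbb{K}$ with variables the vertices of $\mathcal{C}$. A homogeneous ideal $I$ generated in a single degree $d$ has a linear resolution if its graded Betti numbers satisfy $\beta_{i,j}(I)=0$ whenever $j\neq i+d$; the zero ideal is regarded as having a linear resolution. *)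

(* Defs.v *)
From mathcomp Require Import all_boot all_order all_algebra.
From mathcomp Require Import mpoly.

Set Implicit Arguments.
Unset Strict Implicit.
Unset Printing Implicit Defensive.

Import GRing.Theory.
Local Open Scope ring_scope.

Section Graphs.
Variable V : finType.
Implicit Types (e f : rel V) (A W : {set V}).

Definition restrict_rel e A : rel V :=
  [rel x y | [&& x \in A, y \in A & e x y]].

Definition induced_connected e A : bool :=
  (A != set0) && [forall x in A, forall y in A, connect (restrict_rel e A) x y].

(* [(W, f)] is the subgraph with vertex set [W] and adjacency [f]; it need not
   be induced. *)
Definition is_subgraph e W f : Prop :=
  ssrbool.symmetric f /\ (forall x y, f x y -> [&& x \in W, y \in W & e x y]).

(* A single edge counts as 2-connected, so that bridges are blocks. *)
Definition two_connected W f : Prop :=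
  [/\ (1 < #|W|)%N, induced_connected f W
    & forall x, x \in W -> induced_connected f (W :\ x)].

Definition is_block e W f : Prop :=
  [/\ is_subgraph e W f, two_connected W f
    & forall W' f', is_subgraph e W' f' -> two_connected W' f' ->
        W \subset W' -> subrel f f' -> W' = W /\ f' =2 f].

Definition block_graph e : Prop :=
  forall W f, is_block e W f ->
    forall x y, x \in W -> y \in W -> x != y -> f x y.

Definition no_isolated_vertex e : Prop := forall x, exists y, e x y.

Definition connected_clutter (r : nat) e : {set {set V}} :=
  [set A : {set V} | (#|A| == r.+1) && induced_connected e A].

Definition complement_clutter (d : nat) (C : {set {set V}}) : {set {set V}} :=
  [set A : {set V} | (#|A| == d) && (A \notin C)].

End Graphs.

Section Ideals.
Variables (K : fieldType) (n : nat).
Local Notation S := {mpoly K[n]}.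

Definition ideal_gen (s : seq S) : S -> Prop :=
  fun p => exists c : 'I_(size s) -> S, p = \sum_i c i * s`_i.

Definition generated_in_degree (d : nat) (I : S -> Prop) : Prop :=
  exists2 s : seq S, {in s, forall p, p \is d.-homog}
    & forall p, I p <-> ideal_gen s p.

(* The i-th module is the sum of the [S(- shift k)] over [k : 'I_(rank i)].
   Its elements are row vectors, so maps act by right multiplication. *)
Record graded_free_data := GradedFreeData {
  rank : nat -> nat;
  shift : forall i, 'I_(rank i) -> nat;
  aug : 'cV[S]_(rank 0);
  bdry : forall i, 'M[S]_(rank i.+1, rank i) }.

Implicit Types (F : graded_free_data) (I : S -> Prop).

Definition degree_preserving F : Prop :=
  (forall k, aug F k 0 \is (shift k).-homog) /\
  (forall i (k : 'I_(rank F i.+1)) (l : 'I_(rank F i)),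
     if (shift l <= shift k)%N then bdry F i k l \is (shift k - shift l).-homog
     else bdry F i k l == 0).

Definition resolves F I : Prop :=
  [/\ forall p, I p <-> exists v : 'rV[S]_(rank F 0), p = (v *m aug F) 0 0,
      forall v : 'rV[S]_(rank F 0),
        v *m aug F = 0 <-> exists w, v = w *m bdry F 0
    & forall i (v : 'rV[S]_(rank F i.+1)),
        v *m bdry F i = 0 <-> exists w, v = w *m bdry F i.+1].

(* The entries of the differentials lie in the ideal of the variables. *)
Definition minimal F : Prop :=
  forall i (k : 'I_(rank F i.+1)) (l : 'I_(rank F i)),
    (bdry F i k l)@_0%MM = 0.

Definition minimal_graded_free_resolution F I : Prop :=
  [/\ degree_preserving F, resolves F I & minimal F].

Definition is_graded_betti (beta : nat -> nat -> nat) I : Prop :=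
  exists2 F, minimal_graded_free_resolution F I
    & forall i j, beta i j = #|[set k : 'I_(rank F i) | shift k == j]|.

(* The zero ideal is included: it is generated by [::] in every degree, and
   all its graded Betti numbers vanish. *)
Definition has_linear_resolution I : Prop :=
  exists2 d, generated_in_degree d I
    & exists2 beta, is_graded_betti beta I
        & forall i j, j <> (i + d)%N -> beta i j = 0%N.

End Ideals.

Definition edge_monomial (K : fieldType) (V : finType) (A : {set V}) :
    {mpoly K[#|V|]} :=
  \prod_(x in A) 'X_(enum_rank x).

Definition edge_ideal (K : fieldType) (V : finType) (C : {set {set V}}) :
    {mpoly K[#|V|]} -> Prop :=
  ideal_gen [seq @edge_monomial K V A | A in C].

Arguments edge_ideal K {V} C _.

(* Main.v *)
Require Import Defs.
From Stdlib Require Import IndefiniteDescription.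
From mathcomp Require Import all_boot all_order all_algebra.
From mathcomp Require Import mpoly.

(** Write the ideal in question as generated by the disconnected sets of [r.+1]
    vertices.  The idea is to split off one variable at a time: if
    [I' = x J + I], where [J] has a [d]-linear resolution, [I] has a
    [d.+1]-linear one, [I] lies in [J] and [(I : x) = I], then [I'] has a
    [d.+1]-linear resolution.  Indeed [0 -> x I -> x J + I (direct sum) -> I']
    is exact, and the mapping cone of a comparison map between the two
    resolutions at hand is a resolution of [I'] all of whose matrix entries are
    linear forms ([linearly_resolved_cone]).  A family of sets which reduces to
    trivial families by such splittings is called vertex splittable.

    The combinatorial task is to split the family of disconnected sets.  When a
    vertex [w] is put into all the sets, one has to remember that what is added
    later must touch the neighbourhood of [w].  The class of families that is
    stable under splitting is therefore the following: the [k]-subsets [B] of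
    [U] which are not connected transversals, i.e. which are disconnected or
    miss one of prescribed sets [Q].  Adding a simplicial vertex [w] of [U]
    replaces the sets [Q] containing [w] by the neighbourhood of [w]
    ([connected_transversalU1]).  For [k > 1] the containment of [I] in [J] can
    only fail if some [Q] containing [w] is smaller than the closed
    neighbourhood of [w]; since blocks are cliques, all the sets [Q] that arise
    are cut out by blocks, so the only harmful case is [Q = [set w]] inside [U]
    ([split_containment]).

    If no harmless simplicial vertex is left, then every connected transversal
    contains all simplicial vertices of [U].  In a block graph a connected
    proper subset of [U] always leaves out a simplicial vertex
    ([simplicial_outside]), because a non-simplicial vertex is a cut vertex and
    the components beyond it again contain simplicial vertices.  Hence no
    proper subset of [U] is a connected transversal, and the family, consisting
    of all [k]-subsets of [U] or of none, is easily split.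

    From the definition by blocks, only one property of block graphs is used:
    two neighbours of [w] which are connected in the graph without [w] are
    adjacent ([block_graph_cut]), because they lie with [w] on a cycle, and a
    cycle lies in a single block. *)

Set Implicit Arguments.
Unset Strict Implicit.
Unset Printing Implicit Defensive.

Import GRing.Theory.

(** * Connected vertex sets and blocks *)

Section Connectedness.
Variables (V : finType) (e : rel V).
Hypothesis e_sym : ssrbool.symmetric e.
Implicit Types (A B U X : {set V}).

Lemma restrict_connect_sym A : connect_sym (restrict_rel e A).
Proof.
by apply: sym_connect_sym => x y; rewrite /restrict_rel /= e_sym andbCA.
Qed.

Lemma connect_restrictS A B x y : A \subset B ->
  connect (restrict_rel e A) x y -> connect (restrict_rel e B) x y.
Proof.
move=> sAB; apply: connect_sub => u v /= /and3P[uA vA uv].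
by apply: connect1; rewrite /restrict_rel /= uv !(subsetP sAB).
Qed.

Lemma connect_restrict_mem A x y :
  x \in A -> connect (restrict_rel e A) x y -> y \in A.
Proof.
move=> xA /connectP[s + ->]; elim: s x xA => //= z s IHs x xA /andP[].
by case/and3P=> _ zA _; apply: IHs.
Qed.

Lemma induced_connectedP A :
  reflect (A != set0 /\ {in A &, forall x y, connect (restrict_rel e A) x y})
          (induced_connected e A).
Proof.
apply: (iffP andP) => -[nA cA]; split=> //.
  by move=> x y xA yA; have /forall_inP/(_ x xA)/forall_inP/(_ y yA) := cA.
by apply/forall_inP => x xA; apply/forall_inP => y yA; apply: cA.
Qed.

Lemma connected_from A x : x \in A ->
    {in A, forall y, connect (restrict_rel e A) x y} ->
  induced_connected e A.
Proof.
move=> xA cx; apply/induced_connectedP; split; first by apply/set0Pn; exists x.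
move=> y z yA zA; apply: connect_trans (cx z zA).
by rewrite restrict_connect_sym cx.
Qed.

Lemma connected_closed A X x : induced_connected e A ->
    (forall y z, y \in X -> z \in A -> e y z -> z \in X) ->
    x \in A -> x \in X -> A \subset X.
Proof.
move=> /induced_connectedP[_ cA] clX xA xX; apply/subsetP => y yA.
have /connectP[s] := cA x y xA yA; elim: s x xA xX => [|z s IHs] x xA xX /=.
  by move=> _ ->.
case/andP=> /and3P[_ zA xz] sP yE; apply: (IHs z) => //.
exact: clX xX zA xz.
Qed.

Lemma disconnected_closed A : A != set0 -> ~~ induced_connected e A ->
  exists X, [/\ X \subset A, X != set0, X != A &
                forall y z, y \in X -> z \in A -> e y z -> z \in X].
Proof.
move=> nA dA; have [x xA] := set0Pn _ nA.
exists [set y in A | connect (restrict_rel e A) x y]; split.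
- by apply/subsetP => y; rewrite inE => /andP[].
- by apply/set0Pn; exists x; rewrite inE xA connect0.
- apply: contra dA => /eqP XA; apply: (connected_from xA) => y.
  by rewrite -{1}XA inE => /andP[].
move=> y z; rewrite !inE => /andP[yA xy] zA yz; rewrite zA /=.
by apply: connect_trans xy (connect1 _); rewrite /restrict_rel /= yA zA.
Qed.

Lemma closed_disconnected A X : X \subset A -> X != set0 -> X != A ->
    (forall y z, y \in X -> z \in A -> e y z -> z \in X) ->
  ~~ induced_connected e A.
Proof.
move=> sXA /set0Pn[x xX] nXA clX; apply: contraNN nXA => cA.
by rewrite eqEsubset sXA (connected_closed cA clX _ xX) // (subsetP sXA).
Qed.

Lemma connected1 x : induced_connected e [set x].
Proof.
apply: (@connected_from _ x); first by rewrite inE.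
by move=> y /set1P->; apply: connect0.
Qed.

Lemma connectedU A B x : x \in A -> x \in B -> induced_connected e A ->
  induced_connected e B -> induced_connected e (A :|: B).
Proof.
move=> xA xB /induced_connectedP[_ cA] /induced_connectedP[_ cB].
apply: (@connected_from _ x); first by rewrite inE xA.
move=> y /setUP[yA|yB].
  by apply: connect_restrictS (cA _ _ xA yA); apply: subsetUl.
by apply: connect_restrictS (cB _ _ xB yB); apply: subsetUr.
Qed.

Lemma connectedU1 A x w : x \in A -> e w x -> induced_connected e A ->
  induced_connected e (w |: A).
Proof.
move=> xA wx /induced_connectedP[_ cA].
apply: (@connected_from _ x); first by rewrite !inE xA orbT.
move=> y /setU1P[->|yA].
  by apply: connect1; rewrite /restrict_rel /= !inE eqxx xA e_sym wx !orbT.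
by apply: connect_restrictS (cA _ _ xA yA); apply: subsetUr.
Qed.

Lemma sorted_connected x s : path e x s ->
  induced_connected e [set y in x :: s].
Proof.
elim: s x => [|z s IHs] x /=.
  rewrite (_ : [set _ in _] = [set x]) ?connected1 //.
  by apply/setP=> y; rewrite !inE.
case/andP=> xz /IHs cs; rewrite set_cons.
by apply: connectedU1 xz cs; rewrite !inE eqxx.
Qed.

End Connectedness.

Section BlockGraph.
Variables (V : finType) (e : rel V).
Hypothesis e_sym : ssrbool.symmetric e.
Implicit Types (A B U W X : {set V}).

Definition induced_two_connected W : bool :=
  [&& 1 < #|W|, induced_connected e W
    & [forall x in W, induced_connected e (W :\ x)]].

Lemma restrict_rel_id A W : A \subset W ->
  induced_connected (restrict_rel e W) A = induced_connected e A.
Proof.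
move=> sAW; congr (_ && _); apply: eq_forallb_in => x xA.
apply: eq_forallb_in => y yA; apply: eq_connect => u v.
rewrite /restrict_rel /=.
by case: (boolP (u \in A)) => //= uA; case: (boolP (v \in A)) => //= vA;
  rewrite !(subsetP sAW).
Qed.

Lemma subgraph_connected f A : subrel f e ->
  induced_connected f A -> induced_connected e A.
Proof.
move=> sfe /andP[nA cA]; rewrite /induced_connected nA /=.
apply/forall_inP => x xA; apply/forall_inP => y yA.
have /forall_inP/(_ x xA)/forall_inP/(_ y yA) := cA.
apply: connect_sub => u v /= /and3P[uA vA uv].
by apply: connect1; rewrite /restrict_rel /= uA vA sfe.
Qed.

Lemma two_connected_induced W f : is_subgraph e W f ->
  two_connected W f -> induced_two_connected W.
Proof.
move=> [_ sfe] [W1 cW cWx]; have {}sfe : subrel f e.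
  by move=> x y /sfe/and3P[].
apply/and3P; split=> //; first exact: subgraph_connected cW.
by apply/forall_inP => x /cWx; apply: subgraph_connected.
Qed.

Lemma induced_two_connectedP W : induced_two_connected W ->
  is_subgraph e W (restrict_rel e W) /\ two_connected W (restrict_rel e W).
Proof.
case/and3P=> W1 cW /forall_inP cWx; split.
  by split=> // x y; rewrite /restrict_rel /= e_sym andbCA.
split=> //; first by rewrite restrict_rel_id.
by move=> x xW; rewrite restrict_rel_id ?subsetDl // cWx.
Qed.

(** A subgraph is 2-connected only if the induced subgraph on its vertices is,
    so blocks can be sought among induced subgraphs, where maximality is a
    matter of finite sets. *)
Lemma maxset_is_block W : maxset induced_two_connected W ->
  is_block e W (restrict_rel e W).
Proof.
case/maxsetP=> /induced_two_connectedP[sW cW] maxW; split=> // W' f sW' cW'.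
move=> sWW' sf; have {sWW'} WW' : W' = W.
  by apply: maxW sWW'; apply: two_connected_induced sW' cW'.
split=> // x y; apply/idP/idP; last exact: sf.
by case: sW' => _ /[apply]; rewrite WW' /restrict_rel /=.
Qed.

Lemma block_graph_adj W x y : block_graph e -> induced_two_connected W ->
  x \in W -> y \in W -> x != y -> e x y.
Proof.
move=> eB /maxset_exists[W' W'max sWW'] xW yW xy.
have := eB _ _ (maxset_is_block W'max) x y.
by rewrite !(subsetP sWW') // => /(_ isT isT xy)/and3P[].
Qed.

(** This is the shape left of a cycle through [w] when another vertex is
    removed: [w] and one or two paths with an end adjacent to [w]. *)
Lemma cone_path_connected w s : sorted e s ->
    (s != [::] -> e w (head w s) \/ e w (last w s)) ->
  induced_connected e (w |: [set y in s]).
Proof.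
case: s => [_ _|x s] /=.
  by rewrite set_nil setU0 connected1.
move=> sP /(_ isT) ew; have sC := sorted_connected e_sym sP.
case: ew => ew; first by apply: connectedU1 ew sC; rewrite ?inE ?eqxx.
by apply: (connectedU1 e_sym _ ew sC); rewrite inE mem_last.
Qed.

(** A simple path from [p] to [q] avoiding [w] closes up to a cycle through
    [w].  Cycles are 2-connected, hence contained in a block, which is a
    clique. *)
Lemma block_graph_cut w p q : block_graph e ->
    e w p -> e w q -> p != q ->
  connect (restrict_rel e [set~ w]) p q -> e p q.
Proof.
move=> eB wp wq pq /connectP[s0 /shortenP[s sP sU _] qE].
have sE : path e p s by apply: sub_path sP => x y /= /and3P[].
have [pw|pw] := eqVneq p w.
  case: s sP {sU sE} qE => [_ /esym/eqP|x s /=]; first by rewrite (negPf pq).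
  by rewrite /restrict_rel /= pw !inE eqxx.
have ws : w \notin p :: s.
  rewrite inE eq_sym (negPf pw) /=.
  elim: s p {pq wp pw qE sU sE} sP => //= x s IHs p.
  case/andP=> /and3P[_ + _] /IHs; rewrite !inE negb_or => xw ->.
  by rewrite eq_sym xw.
have [pS qS] : p \in p :: s /\ q \in p :: s by rewrite qE mem_last inE eqxx.
apply: (@block_graph_adj (w |: [set y in p :: s])) => //;
  try by rewrite in_setU1 inE ?pS ?qS orbT.
apply/and3P; split.
- have <- : #|[set p; q]| = 2 by rewrite cards2 pq.
  apply/subset_leq_card/subsetP=> y /set2P[]->;
    by rewrite in_setU1 inE ?pS ?qS orbT.
- by apply: cone_path_connected => //= _; left.
apply/forall_inP => x /setU1P[->|].
  rewrite setU1K ?inE // sorted_connected //.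
rewrite inE => xS; have xw : x != w by apply: contraNneq ws => <-.
have [s1 [s2 sE12]] : exists s1 s2, p :: s = s1 ++ x :: s2.
  by case/splitPr: xS => s1 s2; exists s1, s2.
(* Removing [x] from the cycle leaves two paths, starting at [p] and ending at
   [q] respectively; [w] glues them, and either may be empty. *)
have sorted12 : sorted e (p :: s) by [].
rewrite sE12 in sorted12; move: sU; rewrite sE12 uniq_catC /=.
rewrite mem_cat negb_or => /andP[/andP[xs2 xs1] _].
have -> : (w |: [set y in s1 ++ x :: s2]) :\ x =
          (w |: [set y in s1]) :|: (w |: [set y in s2]).
  apply/setP=> y; rewrite !inE mem_cat inE.
  case: (eqVneq y x) => [->|yx] /=; last by rewrite orbACA orbb.
  by rewrite (negPf xs1) (negPf xs2) (negPf xw).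
apply: (@connectedU _ _ e_sym _ _ w); rewrite ?inE ?eqxx //.
  apply: cone_path_connected; first by case/cat_sorted2: sorted12.
  by case: s1 sE12 {xs1 sorted12} => //= y s1 [<-] _ _; left.
apply: cone_path_connected.
  by case/cat_sorted2: sorted12 => _ /path_sorted.
move: qE; rewrite -[last p s]/(last w (p :: s)) sE12 last_cat /=.
by case: s2 {sE12 xs2 sorted12} => //= y s2 qE _; right; rewrite -qE.
Qed.

End BlockGraph.

(** * Vertex splittable families *)

(** [vertex_splittable k C] is about families [C] of [k]-sets.  In the last
    constructor the edge ideal of the family is [x_w J + I], with [J] and [I]
    the edge ideals of [A] and [B]; the last hypothesis says that [I] lies in
    [J]. *)
Inductive vertex_splittable (V : finType) : nat -> {set {set V}} -> Prop :=
| SplitEmpty k : vertex_splittable k set0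
| SplitUnit : vertex_splittable 0 [set set0]
| SplitVertex k (w : V) (A B : {set {set V}}) :
    vertex_splittable k A -> vertex_splittable k.+1 B ->
    (forall a, a \in A -> w \notin a) -> (forall b, b \in B -> w \notin b) ->
    (forall b, b \in B -> exists2 a, a \in A & a \subset b) ->
    vertex_splittable k.+1 ([set w |: a | a : {set V} in A] :|: B).

Section SplitFamilies.
Variable V : finType.
Implicit Types (A B U : {set V}) (P : pred {set V}).

Definition ksubsets U k P : {set {set V}} :=
  [set B : {set V} | [&& B \subset U, #|B| == k & P B]].

Lemma eq_ksubsets U k P P' :
    (forall B, B \subset U -> #|B| = k -> P B = P' B) ->
  ksubsets U k P = ksubsets U k P'.
Proof.
move=> eqPP'; apply/setP => B; rewrite !inE.
by case: (boolP (B \subset U)) => //= sBU; case: eqP => //= cB; apply: eqPP'.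
Qed.

Lemma ksubsets0 U P : vertex_splittable 0 (ksubsets U 0 P).
Proof.
have [P0|nP0] := boolP (P set0).
  rewrite (_ : ksubsets _ _ _ = [set set0]); first exact: SplitUnit.
  apply/setP => B; rewrite !inE cards_eq0.
  by case: eqP => [->|]; rewrite ?sub0set ?andbF.
rewrite (_ : ksubsets _ _ _ = set0); first exact: SplitEmpty.
apply/setP => B; rewrite !inE cards_eq0; case: eqP => [->|]; rewrite ?andbF //.
by rewrite (negPf nP0) !andbF.
Qed.

Lemma ksubsetsS U k w P : w \in U ->
  ksubsets U k.+1 P =
    [set w |: a | a : {set V} in ksubsets (U :\ w) k (fun B => P (w |: B))]
      :|: ksubsets (U :\ w) k.+1 P.
Proof.
move=> wU; apply/setP => B; rewrite !inE subsetD1.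
have [wB|wB] /= := boolP (w \in B); last first.
  rewrite andbT (_ : B \in _ = false) //.
  by apply/imsetP => -[a _ BE]; rewrite BE setU11 in wB.
rewrite andbF orbF; apply/idP/imsetP => [/and3P[sBU cB PB]|[a + ->]].
  exists (B :\ w); rewrite ?setD1K // inE subsetD1 setD11 andbT.
  rewrite (subset_trans (subsetDl _ _) sBU) setD1K // PB andbT /=.
  by move: cB; rewrite (cardsD1 w) wB.
rewrite inE subsetD1 => /and3P[/andP[sAU wa] ca ->].
by rewrite subUset sub1set wU sAU cardsU1 wa (eqP ca) /= add1n eqxx.
Qed.

(** The subsets containing [w] and those avoiding [w] are again given by
    predicates on the subsets of [U :\ w], so splitting at [w] stays inside the
    families of this form. *)
Lemma ksubsets_split U k w P : w \in U ->
    vertex_splittable k (ksubsets (U :\ w) k (fun B => P (w |: B))) ->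
    vertex_splittable k.+1 (ksubsets (U :\ w) k.+1 P) ->
    (forall B, B \subset U :\ w -> #|B| = k.+1 -> P B ->
       exists2 b, b \in B & P (w |: (B :\ b))) ->
  vertex_splittable k.+1 (ksubsets U k.+1 P).
Proof.
move=> wU sA sB BA; rewrite (ksubsetsS k P wU); apply: SplitVertex => //.
- by move=> a; rewrite inE subsetD1 => /and3P[/andP[]].
- by move=> b; rewrite inE subsetD1 => /and3P[/andP[]].
move=> B; rewrite inE => /and3P[sBU /eqP cB PB].
have [b bB Pb] := BA B sBU cB PB.
exists (B :\ b); last exact: subsetDl.
rewrite inE Pb (subset_trans (subsetDl _ _) sBU) andbT /=.
by rewrite -eqSS -cB (cardsD1 b B) bB.
Qed.

Lemma ksubsets_all U k : vertex_splittable k (ksubsets U k xpredT).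
Proof.
elim: {U}_.+1 {-2}U k (ltnSn #|U|) => // n IHn U [|k] leU.
  exact: ksubsets0.
have [->|[w wU]] := set_0Vmem U.
  rewrite (_ : ksubsets _ _ _ = set0); first exact: SplitEmpty.
  apply/setP => B; rewrite !inE subset0; case: eqP => //= ->.
  by rewrite cards0.
have ltUw : #|U :\ w| < n by move: leU; rewrite (cardsD1 w U) wU.
apply: (ksubsets_split wU); try exact: IHn.
move=> B _ cB _; have /card_gt0P[b bB] : 0 < #|B| by rewrite cB.
by exists b.
Qed.

Lemma ksubsets1 U P : vertex_splittable 1 (ksubsets U 1 P).
Proof.
elim: {U}_.+1 {-2}U (ltnSn #|U|) => // n IHn U leU.
have [->|[w wU]] := set_0Vmem U.
  rewrite (_ : ksubsets _ _ _ = set0); first exact: SplitEmpty.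
  apply/setP => B; rewrite !inE subset0; case: eqP => //= ->.
  by rewrite cards0.
have ltUw : #|U :\ w| < n by move: leU; rewrite (cardsD1 w U) wU.
have [Pw|nPw] := boolP (P [set w]).
  apply: (ksubsets_split wU); [exact: ksubsets0|exact: IHn|].
  move=> B _ /eqP/cards1P[b ->] _; exists b; rewrite ?set11 //.
  by rewrite setDv setU0.
rewrite (_ : ksubsets U 1 P = ksubsets (U :\ w) 1 P); first exact: IHn.
apply/setP => B; rewrite !inE; have [/cards1P[b ->]|] := boolP (#|B| == 1).
  rewrite !sub1set !inE; case: eqP => //= ->.
  by rewrite (negPf nPw) !andbF.
by rewrite !andbF.
Qed.

(** Only the case [k = #|U|] can see the value of [P] at [U], and there the
    family is empty or all of the [k]-subsets. *)
Lemma ksubsets_full U k P : (forall B, B \proper U -> P B) ->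
  vertex_splittable k (ksubsets U k P).
Proof.
move=> allP; have [PU|nPU] := boolP (P U).
  rewrite (@eq_ksubsets _ _ _ xpredT); first exact: ksubsets_all.
  by move=> B; rewrite subEproper => /predU1P[->|/allP ->].
have [kU|kU] := eqVneq #|U| k.
  rewrite (_ : ksubsets _ _ _ = set0); first exact: SplitEmpty.
  apply/setP => B; rewrite !inE; apply/and3P => -[sBU /eqP cB PB].
  case/negP: nPU; suff <- : B = U by [].
  by apply/eqP; rewrite eqEcard sBU cB kU leqnn.
rewrite (@eq_ksubsets _ _ _ xpredT); first exact: ksubsets_all.
move=> B; rewrite subEproper => /predU1P[->|/allP ->] //.
by move/eqP; rewrite (negPf kU).
Qed.

End SplitFamilies.

(** * Connected transversals in block graphs *)

Section BlockGraphSplit.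
Variables (V : finType) (e : rel V).
Hypothesis e_sym : ssrbool.symmetric e.
Hypothesis e_irr : irreflexive e.
Hypothesis cut : forall w p q, e w p -> e w q -> p != q ->
  connect (restrict_rel e [set~ w]) p q -> e p q.
Implicit Types (A B U X Q : {set V}) (QQ : {set {set V}}).

Definition simplicial U w : bool :=
  [forall p in U, forall q in U, [&& e w p, e w q & p != q] ==> e p q].

Lemma simplicialP U w :
  reflect {in U &, forall p q, e w p -> e w q -> p != q -> e p q}
          (simplicial U w).
Proof.
apply: (iffP forall_inP) => [H p q pU qU wp wq pq|H p pU].
  by have /forall_inP/(_ q qU)/implyP := H p pU; apply; rewrite wp wq.
by apply/forall_inP => q qU; apply/implyP => /and3P[]; apply: H.
Qed.

(** Blocks meet in at most one vertex: two triangles sharing the edge [a b]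
    span a clique, as [b] connects their other vertices in the graph without
    [a]. *)
Lemma no_diamond w a b y : e w a -> e w b -> a != b -> e a b ->
  y != w -> e a y -> e b y -> e w y.
Proof.
move=> wa wb ab eab yw ay bY; rewrite e_sym.
have neq x z : e x z -> z != x by apply: contraTneq => ->; rewrite e_irr.
have eaw : e a w by rewrite e_sym.
apply: (cut ay eaw yw); apply: (@connect_trans _ _ b); apply: connect1.
  by apply/and3P; split; rewrite ?inE ?neq // e_sym.
by apply/and3P; split; rewrite ?inE ?neq // e_sym.
Qed.

(** If [d] is not simplicial it has two non-adjacent neighbours, which [d]
    separates; one of them is cut off from [w] by [d], and its component in
    [U :\ d] is strictly inside the component of [d] in [U :\ w].  Descending
    in this way ends at a simplicial vertex. *)
Lemma component_simplicial U w d : d \in U :\ w ->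
  exists s, [/\ s \in U, simplicial U s &
                connect (restrict_rel e (U :\ w)) d s].
Proof.
pose comp w d := [set x in U :\ w | connect (restrict_rel e (U :\ w)) d x].
elim: {w d}_.+1 {-2}w {-2}d (ltnSn #|comp w d|) => // n IHn w d leD dUw.
have /setD1P[dw dU] := dUw.
have [sd|] := boolP (simplicial U d); first by exists d; rewrite connect0.
rewrite /simplicial negb_forall_in => /exists_inP[p pU].
rewrite negb_forall_in => /exists_inP[q qU].
rewrite negb_imply => /andP[/and3P[dp dq pq] npq].
have subC : forall x y, connect (restrict_rel e (U :\ d)) x y ->
    connect (restrict_rel e [set~ d]) x y.
  move=> x y; apply: connect_restrictS.
  by apply/subsetP=> z /setD1P[zd _]; rewrite !inE.
have CS := restrict_connect_sym e_sym.
wlog npw : p q pU qU dp dq pq npq / ~~ connect (restrict_rel e (U :\ d)) p w.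
  move=> IH; have [pw|] := boolP (connect (restrict_rel e (U :\ d)) p w);
    last exact: IH pq npq.
  apply: (IH q p) => //; [by rewrite eq_sym | by rewrite e_sym |].
  apply: contra npq => qw; apply: (cut dp dq pq); apply: subC.
  by apply: connect_trans pw _; rewrite CS.
have pUd : p \in U :\ d.
  by rewrite !inE pU andbT; apply: contraTneq dp => ->; rewrite e_irr.
(* The component of [p] in [U :\ d] avoids [w], hence it survives in
   [U :\ w], where the edge from [d] to [p] attaches it to [d]. *)
have reach x : connect (restrict_rel e (U :\ d)) p x ->
    x \in U :\ d /\ connect (restrict_rel e (U :\ w)) d x.
  move=> px; split; first exact: connect_restrict_mem pUd px.
  have pw : p \in U :\ w.
    by rewrite !inE pU andbT; apply: contraNneq npw => ->; apply: connect0.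
  apply: (@connect_trans _ _ p).
    by apply: connect1; rewrite /restrict_rel /= dUw pw.
  have walk t y : connect (restrict_rel e (U :\ d)) p y -> y \in U :\ w ->
      path (restrict_rel e (U :\ d)) y t ->
      connect (restrict_rel e (U :\ w)) y (last y t).
    elim: t y => [|z t IHt] y py yw /=; first by move=> _; apply: connect0.
    case/andP=> yz tP; have pz := connect_trans py (connect1 yz).
    have zw : z \in U :\ w.
      case/and3P: yz => _ /setD1P[_ zU] _.
      by rewrite !inE zU andbT; apply: contraNneq npw => <-; exact: pz.
    apply: (@connect_trans _ _ z); last exact: IHt.
    by apply: connect1; rewrite /restrict_rel /= yw zw; case/and3P: yz.
  by have /connectP[t tP ->] := px; apply: walk.
have ltC : #|comp d p| < n.
  rewrite ltnS in leD; apply: leq_trans leD.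
  apply: proper_card; apply/properP; split.
    apply/subsetP => x; rewrite inE => /andP[_ /reach[_ dx]].
    by rewrite inE dx andbT (connect_restrict_mem dUw dx).
  by exists d; rewrite !inE ?dU ?dw ?connect0 // eqxx.
by have [s [sU ss /reach[_ ds]]] := IHn d p ltC pUd; exists s.
Qed.

(** A vertex of [U] outside [B] is simplicial or a cut vertex.  In the latter
    case the connected set [B] sits on one side only, and another side has a
    simplicial vertex by [component_simplicial]. *)
Lemma simplicial_outside U B : B \proper U -> induced_connected e B ->
  exists2 s, s \in U :\: B & simplicial U s.
Proof.
case/properP=> sBU [w wU wB] cB.
have [sw|] := boolP (simplicial U w); first by exists w; rewrite // inE wB.
rewrite /simplicial negb_forall_in => /exists_inP[p pU].
rewrite negb_forall_in => /exists_inP[q qU].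
rewrite negb_imply => /andP[/and3P[wp wq pq] npq].
have CS := restrict_connect_sym e_sym.
have [nB cBB] := induced_connectedP _ _ cB.
have sBUw : B \subset U :\ w by rewrite subsetD1 sBU.
wlog far : p q pU qU wp wq pq npq /
    forall b, b \in B -> ~~ connect (restrict_rel e (U :\ w)) p b.
  move=> IH; have [/exists_inP[b bB pb]|] :=
    boolP [exists b in B, connect (restrict_rel e (U :\ w)) p b]; last first.
    by rewrite negb_exists_in => /forall_inP; apply: IH pq npq.
  apply: (IH q p) => //; [by rewrite eq_sym | by rewrite e_sym |].
  move=> c cinB; apply: contra npq => qc; apply: (cut wp wq pq).
  apply: (@connect_restrictS _ _ (U :\ w)).
    by apply/subsetP=> z /setD1P[zd _]; rewrite !inE.
  apply: connect_trans pb _; rewrite CS; apply: connect_trans qc _.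
  by apply: connect_restrictS sBUw _; apply: cBB.
have pUw : p \in U :\ w.
  by rewrite !inE pU andbT; apply: contraTneq wp => ->; rewrite e_irr.
have [s [sU ss ps]] := component_simplicial pUw.
by exists s; rewrite // inE sU andbT; apply: contraL ps => /far.
Qed.

Definition neighbours w : {set V} := [set x | e w x].

Definition connected_transversal QQ B : bool :=
  induced_connected e B && [forall Q in QQ, B :&: Q != set0].

(** Inside [U], the set [Q] has at most one element or is a maximal clique.
    Comparing with [U] only makes the property pass to smaller [U] with the
    same [Q].  The wording by pairs is that of a line through two points: in a
    block graph an edge lies in exactly one maximal clique. *)
Definition line_like U Q : Prop :=
  {in Q :&: U &, forall a b, a != b ->
     e a b /\ {in U, forall y, e a y -> e b y -> y \in Q}}.

Lemma line_likeS U U' Q : U' \subset U -> line_like U Q -> line_like U' Q.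
Proof.
move=> sU lQ a b aQ bQ ab; have sQ := setIS Q sU.
have [eab lab] := lQ a b (subsetP sQ _ aQ) (subsetP sQ _ bQ) ab.
by split=> // y yU; apply: lab; apply: (subsetP sU).
Qed.

Lemma neighbours_line_like U w : simplicial U w ->
  line_like (U :\ w) (neighbours w).
Proof.
move=> /simplicialP sw a b.
rewrite !inE => /and3P[wa aw aU] /and3P[wb bw bU] ab.
have eab := sw a b aU bU wa wb ab; split=> // y /setD1P[yw _] ay bY.
by rewrite inE (no_diamond wa wb).
Qed.

(** The neighbours of [w] in [U] form a clique, so they lie on one side of any
    separation of [B], and [w] cannot join two components of [B]. *)
Lemma connectedU1_simplicial U w B : simplicial U w -> B \subset U :\ w ->
    B != set0 ->
  induced_connected e (w |: B) =
    induced_connected e B && (B :&: neighbours w != set0).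
Proof.
move=> /simplicialP sw; rewrite subsetD1 => /andP[sBU wB] nB.
apply/idP/andP => [cwB|[cB /set0Pn[x]]]; last first.
  by rewrite !inE => /andP[xB wx]; apply: connectedU1 wx cB.
have meetN : B :&: neighbours w != set0.
  apply: contraTneq cwB => BN0.
  apply: (@closed_disconnected _ _ _ [set w]); rewrite ?sub1set ?setU11 //.
  - by apply/set0Pn; exists w; rewrite set11.
  - apply: contraNneq nB => wBE; rewrite -subset0; apply/subsetP => x xB.
    have : x \in [set w] by rewrite wBE inE xB orbT.
    by move/set1P=> xw; rewrite xw (negPf wB) in xB.
  move=> y z /set1P-> /setU1P[->|zB] wz; first by rewrite set11.
  by have := in_set0 z; rewrite -BN0 !inE zB wz.
split=> //; apply: contraTT cwB => dB.
have [X [sXB nX nXB clX]] := disconnected_closed e_sym nB dB.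
have wNX (Y : {set V}) : Y \subset B -> w \notin Y.
  move=> sYB; apply: contra wB => wY. exact: (subsetP sYB).
have [XN|/set0Pn[x /setIP[xX]]] := eqVneq (X :&: neighbours w) set0.
  apply: (@closed_disconnected _ _ _ X) => //.
  - exact: subset_trans sXB (subsetUr _ _).
  - by apply: contraTneq (wNX _ sXB) => ->; rewrite setU11.
  move=> y z yX /setU1P[->|zB] yz; last exact: clX yX zB yz.
  by have := in_set0 y; rewrite -XN !inE yX e_sym yz.
rewrite inE => wx; apply: (@closed_disconnected _ _ _ (w |: X)).
- exact: setUS.
- by apply/set0Pn; exists w; rewrite setU11.
- apply: contraNneq nXB => wXB; apply/eqP/setP => z.
  have := congr1 (fun Y : {set V} => z \in Y :\ w) wXB.
  by rewrite !setU1K ?wNX.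
move=> y z /setU1P[->|yX] /setU1P[->|zB] yz; rewrite ?setU11 //; last first.
  by rewrite inE (clX y z) ?orbT.
have [->|xz] := eqVneq z x; first by rewrite inE xX orbT.
rewrite inE (clX x z) ?orbT //; apply: sw => //; last by rewrite eq_sym.
  exact: (subsetP sBU _ (subsetP sXB _ xX)).
exact: (subsetP sBU).
Qed.

(** Once [w] is chosen, the sets [Q] containing [w] are met, and connectedness
    asks for a vertex in the neighbourhood of [w]. *)
Lemma connected_transversalU1 U w B QQ : simplicial U w ->
    B \subset U :\ w -> B != set0 ->
  connected_transversal QQ (w |: B) =
  connected_transversal (neighbours w |: [set Q in QQ | w \notin Q]) B.
Proof.
move=> sw sBU nB; rewrite /connected_transversal.
rewrite (connectedU1_simplicial sw) // -andbA; congr (_ && _).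
apply/andP/forall_inP => [[mN /forall_inP mQ] Q|mQ].
  rewrite !inE => /predU1P[->//|/andP[QQQ wQ]].
  have := mQ Q QQQ; rewrite setIUl (_ : [set w] :&: Q = set0) ?set0U //.
  apply/setP => x; rewrite !inE; case: eqP => //= ->; exact: negbTE.
split; first by apply: mQ; rewrite setU11.
apply/forall_inP => Q QQQ; have [wQ|wQ] := boolP (w \in Q).
  by apply/set0Pn; exists w; rewrite inE setU11.
have /set0Pn[x /setIP[xB xQ]] : B :&: Q != set0.
  by apply: mQ; rewrite !inE QQQ wQ orbT.
by apply/set0Pn; exists x; rewrite !inE xB xQ orbT.
Qed.

(** If [B] misses a set [Q] without [w], any [b] will do.  If [B] misses a [Q]
    containing [w], then [Q] has a second vertex in [U], hence contains all
    neighbours of [w] in [U], and [B] misses these.  If [B] is disconnected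
    with at least three vertices, one can be removed so that two parts remain.
    If [B] consists of two non-adjacent vertices, one of them is not adjacent
    to the simplicial vertex [w], and the other one is removed. *)
Lemma split_containment U w QQ B : simplicial U w -> w \in U ->
    (forall Q, Q \in QQ -> line_like U Q) ->
    (forall Q, Q \in QQ -> Q :&: U != [set w]) ->
    B \subset U :\ w -> 1 < #|B| -> ~~ connected_transversal QQ B ->
  exists2 b, b \in B & ~~ connected_transversal QQ (w |: (B :\ b)).
Proof.
move=> sw wU lQ nQ sBU B1 badB.
have sB'U b : B :\ b \subset U :\ w by apply: subset_trans sBU; apply: subsetDl.
have nB' b : b \in B -> B :\ b != set0.
  by move=> bB; rewrite -card_gt0; move: B1; rewrite (cardsD1 b) bB.
have nB : B != set0 by rewrite -card_gt0 ltnW.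
suff [b bB bad] : exists2 b, b \in B & ~~ induced_connected e (B :\ b) \/
    exists2 Q, Q \in neighbours w |: [set Q in QQ | w \notin Q]
             & (B :\ b) :&: Q == set0.
  exists b => //; rewrite (connected_transversalU1 _ sw) ?nB' //.
  rewrite negb_and; case: bad => [->//|[Q QQQ BQ0]]; apply/orP; right.
  by rewrite negb_forall_in; apply/exists_inP; exists Q; rewrite ?negbK.
have sub0 b Q : B :&: Q == set0 -> (B :\ b) :&: Q == set0.
  by rewrite -!subset0 => /(subset_trans _); apply; apply/setSI/subsetDl.
have [b0 b0B] := set0Pn _ nB.
have [cB|dB] := boolP (induced_connected e B).
  move: badB; rewrite /connected_transversal cB /= negb_forall_in.
  case/exists_inP=> Q QQQ; rewrite negbK => BQ0.
  exists b0 => //; right; have [wQ|wQ] := boolP (w \in Q); last first.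
    by exists Q; [rewrite !inE QQQ wQ orbT | apply: sub0].
  exists (neighbours w); first exact: setU11.
  apply: sub0; rewrite -subset0 -(eqP BQ0); apply/subsetP => x.
  rewrite !inE => /andP[xB wx]; rewrite xB /=.
  have xU : x \in U by case/setD1P: (subsetP sBU _ xB).
  have [a aQU aw] : exists2 a, a \in Q :&: U & a \notin [set w].
    apply/subsetPn; apply: contra (nQ Q QQQ) => QUw.
    by rewrite eqEsubset QUw sub1set inE wQ.
  rewrite inE in aw; have wQU : w \in Q :&: U by rewrite inE wQ.
  have [|wa lwa] := lQ Q QQQ w a wQU aQU; first by rewrite eq_sym.
  have [->|xa] := eqVneq x a; first by case/setIP: aQU.
  apply: lwa => //; move/simplicialP: sw; apply; rewrite 1?eq_sym //.
  by case/setIP: aQU.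
have [X [sXB /set0Pn[x xX] nXB clX]] := disconnected_closed e_sym nB dB.
have [y yB yX] : exists2 y, y \in B & y \notin X.
  by have /properP[] : X \proper B by rewrite properEneq nXB.
have xB := subsetP sXB _ xX.
have [z /and3P[zB zx zy]|all2] :=
  pickP (fun z => [&& z \in B, z != x & z != y]).
  exists z => //; left; apply: (@closed_disconnected _ _ _ (X :\ z)).
  - exact: setSD.
  - by apply/set0Pn; exists x; rewrite !inE eq_sym zx.
  - apply: contraNneq yX => XB; have : y \in X :\ z.
      by rewrite XB !inE eq_sym zy.
    by rewrite !inE => /andP[].
  move=> u v /setD1P[_ uX] /setD1P[vz vB] uv.
  by rewrite !inE vz (clX u v).
have Bxy z : z \in B -> z = x \/ z = y.
  move=> zB; have := all2 z; rewrite zB /=.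
  by case: eqP => [|_]; [left | case: eqP => [|//]; right].
have xy : ~~ e x y by apply: contra yX => /(clX _ _ xX yB).
have nxy : x != y by apply: contraNneq yX => <-.
have isoN u v : u \in B -> (forall z, z \in B -> z = u \/ z = v) -> ~~ e w v ->
    (B :\ u) :&: neighbours w == set0.
  move=> uB Buv wv; rewrite -subset0; apply/subsetP => z.
  rewrite !inE => /andP[/andP[zu zB]]; apply: contraTT => _.
  by case: (Buv z zB) zu => ->; rewrite ?eqxx.
have [wx|wx] := boolP (e w x); last first.
  exists y => //; right; exists (neighbours w); first exact: setU11.
  by apply: (isoN y x) => // z /Bxy[]; [right | left].
exists x => //; right; exists (neighbours w); first exact: setU11.
apply: (isoN x y) => //; apply: contra xy => wy.
have inU z : z \in B -> z \in U by move/(subsetP sBU)/setD1P=> [].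
by move/simplicialP: sw; apply => //; apply: inU.
Qed.

(** Induction on [U], splitting at a simplicial vertex [w] to which
    [split_containment] applies.  If there is none, every simplicial vertex of
    [U] is the only vertex of some [Q] in [U], so that connected transversals
    contain all of them and [simplicial_outside] leaves only [U] itself.  The
    case [k = 1] is separate: there the sets to which [w] is added are empty,
    so that [connected_transversalU1] and [split_containment] do not apply. *)
Lemma vertex_splittable_transversal U QQ k :
    (forall Q, Q \in QQ -> line_like U Q) ->
  vertex_splittable k (ksubsets U k (fun B => ~~ connected_transversal QQ B)).
Proof.
elim: {U}_.+1 {-2}U QQ k (ltnSn #|U|) => // n IHn U QQ [|[|k]] leU lQ.
- exact: ksubsets0.
- exact: ksubsets1.
have [/exists_inP[w wU /andP[sw /forall_inP nQ]]|] :=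
  boolP [exists w in U, simplicial U w && [forall Q in QQ, Q :&: U != [set w]]].
  have ltUw : #|U :\ w| < n by move: leU; rewrite (cardsD1 w U) wU.
  apply: (ksubsets_split wU).
  - rewrite (@eq_ksubsets _ _ _ _ (fun B => ~~ connected_transversal
       (neighbours w |: [set Q in QQ | w \notin Q]) B)).
      apply: IHn => // Q /setU1P[->|]; first exact: neighbours_line_like.
      rewrite inE => /andP[/lQ lQQ _].
      by apply: line_likeS lQQ; apply: subsetDl.
    move=> B sBU cB; rewrite (connected_transversalU1 _ sw) //.
    by rewrite -card_gt0 cB.
  - by apply: IHn => // Q /lQ; apply: line_likeS; apply: subsetDl.
  by move=> B sBU cB; apply: split_containment sBU _; rewrite ?cB.
rewrite negb_exists_in => /forall_inP allQ; apply: ksubsets_full => B pB.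
rewrite negb_and -implybE; apply/implyP => cB.
have [s /setDP[sU sB] ss] := simplicial_outside pB cB.
have := allQ s sU; rewrite ss /= negb_forall_in => /exists_inP[Q QQQ].
rewrite negbK => /eqP QUs; rewrite negb_forall_in; apply/exists_inP.
exists Q => //; rewrite negbK -subset0 -(setIidPl (proper_sub pB)).
rewrite -setIA (setIC U) QUs.
by apply/subsetP=> x /setIP[xB /set1P xs]; rewrite xs (negPf sB) in xB.
Qed.

End BlockGraphSplit.

(** * Linear resolutions and mapping cones *)


Lemma dependent_choice (T : nat -> Type) (P : forall i, T i -> Prop)
    (R : forall i, T i -> T i.+1 -> Prop) (x0 : T 0%N) :
    P 0%N x0 ->
    (forall i x, P i x -> exists y, R i x y /\ P i.+1 y) ->
  exists s : forall i, T i,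
    s 0%N = x0 /\ forall i, P i (s i) /\ R i (s i) (s i.+1).
Proof.
move=> P0 step.
pose next i (x : {x | P i x}) := constructive_indefinite_description _
  (step i (sval x) (svalP x)).
pose t i := nat_rect (fun i => {x | P i x}) (exist _ x0 P0)
  (fun i x => exist _ (sval (next i x)) (proj2 (svalP (next i x)))) i.
exists (fun i => sval (t i)); split=> // i; split; first exact: svalP.
exact: (proj1 (svalP (next i (t i)))).
Qed.

Section Linear.
Local Open Scope ring_scope.
Variables (K : fieldType) (n : nat).
Local Notation S := {mpoly K[n]}.
Implicit Types (I J : S -> Prop).

Lemma pihomogM s d (p q : S) : q \is d.-homog ->
  pihomog mdeg (s + d) (p * q) = pihomog mdeg s p * q.
Proof.
move=> hq; pose k := maxn (mmeasure mdeg p) s.+1.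
have pE := @pihomog_partitionE n K mdeg k p (leq_maxl _ _).
rewrite {1}pE mulr_suml raddf_sum /=.
have sk : (s < k)%N by apply: leq_maxr.
rewrite (bigD1 (Ordinal sk)) //= big1 ?addr0 => [|j js].
  by rewrite pihomog_dE // dhomogM // pihomogP.
apply: (@pihomog_ne0 n K mdeg (j + d)%N); last by rewrite dhomogM // pihomogP.
by rewrite eqn_add2r.
Qed.

Definition homogeneous_mx d p q (A : 'M[S]_(p, q)) : Prop :=
  forall i j, A i j \is d.-homog.

Lemma homogeneous_mulmx d d' p q r (A : 'M[S]_(p, q)) (B : 'M[S]_(q, r)) :
  homogeneous_mx d A -> homogeneous_mx d' B -> homogeneous_mx (d + d') (A *m B).
Proof.
by move=> hA hB i j; rewrite mxE rpred_sum // => k _; apply: dhomogM.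
Qed.

Lemma homogeneous_mx0 d p q : homogeneous_mx d (0 : 'M[S]_(p, q)).
Proof. by move=> i j; rewrite mxE dhomog0. Qed.

Lemma homogeneous_row_mx d p q q' (A : 'M[S]_(p, q)) (B : 'M[S]_(p, q')) :
  homogeneous_mx d A -> homogeneous_mx d B -> homogeneous_mx d (row_mx A B).
Proof. by move=> hA hB i j; rewrite mxE; case: split. Qed.

Lemma homogeneous_col_mx d p p' q (A : 'M[S]_(p, q)) (B : 'M[S]_(p', q)) :
  homogeneous_mx d A -> homogeneous_mx d B -> homogeneous_mx d (col_mx A B).
Proof. by move=> hA hB i j; rewrite mxE; case: split. Qed.

(** A factorization through [Y] exists over the polynomial ring; keeping the
    degree one part of its entries gives another one, as [X] and [Y] are
    homogeneous. *)
Lemma homogeneous_factor d p q r (X : 'M[S]_(p, r)) (Y : 'M[S]_(q, r)) :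
    homogeneous_mx d.+1 X -> homogeneous_mx d Y ->
    (forall v : 'rV_p, exists w : 'rV_q, v *m X = w *m Y) ->
  exists2 Phi : 'M[S]_(p, q), homogeneous_mx 1 Phi & Phi *m Y = X.
Proof.
move=> hX hY XY; have /fin_all_exists[w wE] i := XY (delta_mx 0 i).
exists (\matrix_(i, j) pihomog mdeg 1 (w i 0 j)) => [i j|].
  by rewrite mxE pihomogP.
apply/matrixP => i j; rewrite -[RHS](pihomog_dE (hX i j)).
have -> : X i j = (delta_mx 0 i *m X : 'rV_r) 0 j by rewrite -rowE mxE.
rewrite wE !mxE raddf_sum /=; apply: eq_bigr => k _.
by rewrite mxE; apply: esym; exact: (@pihomogM 1).
Qed.

(** All generators of the [i]-th module have degree [i + d], which is the only
    possibility for a linear resolution; minimality is automatic once the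
    matrices have linear forms as entries. *)
Definition linear_data d (b : nat -> nat) (a : 'cV[S]_(b 0%N))
    (D : forall i, 'M[S]_(b i.+1, b i)) : graded_free_data K n :=
  @GradedFreeData K n b (fun i _ => (i + d)%N) a D.

Definition linearly_resolved d I : Prop :=
  exists b a D, [/\ homogeneous_mx d a, forall i, homogeneous_mx 1 (D i)
                  & resolves (@linear_data d b a D) I].

Lemma linearly_resolved_linear d I :
  linearly_resolved d I -> has_linear_resolution I.
Proof.
move=> [b [a [D [ha hD res]]]]; exists d.
  exists [seq a k 0 | k <- enum 'I_(b 0%N)].
    by move=> p /mapP[k _ ->].
  case: res => gen _ _ p; rewrite gen.
  have sz : size [seq a k 0 | k <- enum 'I_(b 0%N)] = b 0%N.
    by rewrite size_map size_enum_ord.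
  have nthE (k : 'I_(b 0%N)) : [seq a k 0 | k <- enum 'I_(b 0%N)]`_k = a k 0.
    by rewrite (nth_map k) ?nth_ord_enum ?size_enum_ord.
  split=> [[v ->]|[c ->]].
    exists (fun k => v 0 (cast_ord sz k)); rewrite mxE /=.
    rewrite (reindex (cast_ord sz)) /=; last first.
      by apply: onW_bij; exists (cast_ord (esym sz)) => k; apply/val_inj.
    apply: eq_bigr => k _; congr (_ * _).
    exact: (esym (nthE (cast_ord sz k))).
  exists (\row_k c (cast_ord (esym sz) k)); rewrite mxE /=.
  rewrite (reindex (cast_ord (esym sz))) /=; last first.
    by apply: onW_bij; exists (cast_ord sz) => k; apply/val_inj.
  by apply: eq_bigr => k _; rewrite mxE nthE.
exists (fun i j => #|[set k : 'I_(b i) | (i + d)%N == j]|) => [|i j ij].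
  exists (linear_data d a D) => //; split=> //.
    split=> [k|i k l] /=; first exact: ha.
    by rewrite leq_add2r leqnSn subnDr subSnn hD.
  move=> i k l; apply: (dhomog_nemf_coeff (hD i k l)).
  by rewrite mf0.
by apply: eq_card0 => k; rewrite inE; apply/eqP => /esym.
Qed.

Lemma linearly_resolved0 d I : (forall p, I p <-> p = 0) ->
  linearly_resolved d I.
Proof.
move=> I0; exists (fun=> 0%N), 0, (fun=> 0); split.
- by case.
- by move=> i [].
split=> /= [p|v|i v].
- by rewrite I0; split=> [->|[v ->]]; [exists 0|]; rewrite mulmx0 mxE.
- by split=> _; [exists 0; rewrite [v]thinmx0 mul0mx|rewrite mulmx0].
- by split=> _; [exists 0; rewrite [v]thinmx0 mul0mx|rewrite mulmx0].
Qed.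

Lemma linearly_resolved1 I : (forall p, I p) -> linearly_resolved 0 I.
Proof.
move=> I1; exists (fun i => if i is 0%N then 1%N else 0%N), 1%:M, (fun=> 0).
split.
- by move=> i j; rewrite !ord1 mxE eqxx dhomog1.
- by move=> i [].
split=> /= [p|v|[|i] v].
- by split=> // _; exists p%:M; rewrite mulmx1 mxE eqxx mulr1n.
- by rewrite mulmx1; split=> [->|[w ->]]; [exists 0|]; rewrite mulmx0.
- by split=> _; [exists 0; rewrite [v]thinmx0 mul0mx|rewrite mulmx0].
- by split=> _; [exists 0; rewrite [v]thinmx0 mul0mx|rewrite mulmx0].
Qed.

Lemma resolves_aug0 (F : graded_free_data K n) I : resolves F I ->
  bdry F 0 *m aug F = 0.
Proof.
move=> [_ ex0 _]; apply/row_matrixP => i; rewrite row0 row_mul.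
by apply/ex0; exists (delta_mx 0 i); rewrite rowE.
Qed.

Lemma resolves_bdry0 (F : graded_free_data K n) I i : resolves F I ->
  bdry F i.+1 *m bdry F i = 0.
Proof.
move=> [_ _ exS]; apply/row_matrixP => k; rewrite row0 row_mul.
by apply/exS; exists (delta_mx 0 k); rewrite rowE.
Qed.

(** The usual lifting of the inclusion of [I] in [J] to the resolutions; the
    generators of [I] are one degree higher, so the lifting can be chosen to
    consist of linear forms. *)
Lemma comparison_map d (b c : nat -> nat) f D g E I J :
    homogeneous_mx d.+1 f -> (forall i, homogeneous_mx 1 (D i)) ->
    resolves (@linear_data d.+1 b f D) I ->
    homogeneous_mx d g -> (forall i, homogeneous_mx 1 (E i)) ->
    resolves (@linear_data d c g E) J ->
    (forall p, I p -> J p) ->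
  exists phi : forall i, 'M[S]_(b i, c i),
    [/\ forall i, homogeneous_mx 1 (phi i), phi 0%N *m g = f
      & forall i, phi i.+1 *m E i = D i *m phi i].
Proof.
move=> hf hD rI hg hE rJ IJ.
have [genI _ _] := rI; have [genJ ex0 exS] := rJ.
rewrite /= in genI genJ ex0 exS.
have [v|phi0 hphi0 phi0E] := homogeneous_factor hf hg.
  have /genJ[w wE] : J ((v *m f) 0 0) by apply/IJ/genI; exists v.
  by exists w; apply/matrixP => i j; rewrite !ord1.
(* The second half of [P] is what allows the next step; its proof in turn uses
   the square that links two consecutive steps. *)
pose P i (phi : 'M[S]_(b i, c i)) := homogeneous_mx 1 phi /\
  forall v : 'rV_(b i.+1), exists w : 'rV_(c i.+1),
    v *m (D i *m phi) = w *m E i.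
pose R i (phi : 'M[S]_(b i, c i)) (psi : 'M[S]_(b i.+1, c i.+1)) :=
  psi *m E i = D i *m phi.
have [||phi [phi0' phiP]] := @dependent_choice _ P R phi0.
- split=> // v; apply/ex0; rewrite -!mulmxA phi0E.
  by rewrite (resolves_aug0 rI) mulmx0.
- move=> i phi [hphi im]; have h2 := homogeneous_mulmx (hD i) hphi.
  have [psi hpsi psiE] := homogeneous_factor h2 (hE i) im.
  exists psi; split=> //; split=> // v; apply/exS; rewrite -!mulmxA psiE.
  by rewrite [D i.+1 *m _]mulmxA (resolves_bdry0 i rI) mul0mx mulmx0.
exists phi; split=> [i||i]; first by case: (phiP i) => -[].
  by rewrite phi0'.
by case: (phiP i).
Qed.

Lemma row_mx3_eq0 p q r (A : 'rV[S]_p) (B : 'rV[S]_q) (C : 'rV[S]_r) :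
  row_mx A (row_mx B C) = 0 <-> [/\ A = 0, B = 0 & C = 0].
Proof.
split=> [ABC0|[-> -> ->]]; last by rewrite !row_mx0.
have [-> BC0] : A = 0 /\ row_mx B C = 0 by apply: eq_row_mx; rewrite row_mx0.
by have [-> ->] : B = 0 /\ C = 0 by apply: eq_row_mx; rewrite row_mx0.
Qed.

Section Cone.
Variables (x : S) (b c : nat -> nat).
Variables (f : 'cV[S]_(b 0%N)) (D : forall i, 'M[S]_(b i.+1, b i)).
Variables (g : 'cV[S]_(c 0%N)) (E : forall i, 'M[S]_(c i.+1, c i)).
Variable phi : forall i, 'M[S]_(b i, c i).

(** The [i]-th module of the cone is the sum of the [i]-th modules of the
    resolutions of [J] (ranks [c]) and [I] (ranks [b]) and of the preceding
    module of the resolution of [I], here with [0] before the start. *)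
Definition prev_rank i := if i is j.+1 then b j else 0%N.

Definition prev_bdry i : 'M[S]_(b i, prev_rank i) :=
  match i with 0%N => 0 | j.+1 => D j end.

Definition cone_rank i := (c i + (b i + prev_rank i))%N.

Definition cone_aug : 'cV[S]_(cone_rank 0) :=
  col_mx (x *: g) (col_mx f 0).

(** Cone of the chain map with components [phi] and [- x], which lifts the map
    [p |-> (x p, - x p)] from [I] to the direct sum of [x J] and [I]. *)
Definition cone_bdry i : 'M[S]_(cone_rank i.+1, cone_rank i) :=
  col_mx (row_mx (E i) 0)
    (col_mx (row_mx 0 (row_mx (D i) 0))
            (row_mx (phi i) (row_mx (- x%:M) (- prev_bdry i)))).

Lemma mul_cone_aug (u : 'rV_(c 0%N)) (v : 'rV_(b 0%N)) (w : 'rV_0) :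
  (row_mx u (row_mx v w) : 'rV_(cone_rank 0)) *m cone_aug =
  x *: (u *m g) + v *m f.
Proof. by rewrite !mul_row_col mulmx0 addr0 scalemxAr. Qed.

Lemma mul_cone_bdry i (u : 'rV_(c i.+1)) (v : 'rV_(b i.+1)) (w : 'rV_(b i)) :
  (row_mx u (row_mx v w) : 'rV_(cone_rank i.+1)) *m cone_bdry i =
  row_mx (u *m E i + w *m phi i)
    (row_mx (v *m D i - x *: w) (- (w *m prev_bdry i))).
Proof.
rewrite !mul_row_col !mul_mx_row !mulmx0 !add_row_mx !add0r !mulmxN.
by rewrite mul_mx_scalar.
Qed.

Lemma cone_row i (y : 'rV[S]_(cone_rank i)) :
  exists u v w, y = row_mx u (row_mx v w).
Proof.
exists (lsubmx y), (lsubmx (rsubmx y)), (rsubmx (rsubmx y)).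
by rewrite !hsubmxK.
Qed.

Lemma cone_rowS i (y : 'rV[S]_(cone_rank i.+1)) :
  exists (u : 'rV_(c i.+1)) (v : 'rV_(b i.+1)) (w : 'rV_(b i)),
    y = row_mx u (row_mx v w).
Proof. exact: cone_row. Qed.

End Cone.

(** The relations [x q + r = 0] with [q] in [J] and [r] in [I] are the pairs
    [(q, - x q)] with [q] in [I], because [x q] in [I] forces [q] in [I].  So
    [I'] is the cokernel of an injective map from [I], shifted by one degree,
    to the direct sum of [x J] and [I], and the mapping cone resolves it. *)
Lemma linearly_resolved_cone d I J I' (x : S) : x != 0 -> x \is 1.-homog ->
    linearly_resolved d J -> linearly_resolved d.+1 I ->
    (forall p, I p -> J p) -> (forall p, I (x * p) -> I p) ->
    (forall p, I' p <-> exists q r, [/\ J q, I r & p = x * q + r]) ->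
  linearly_resolved d.+1 I'.
Proof.
move=> x0 hx [c [g [E [hg hE rJ]]]] [b [f [D [hf hD rI]]]] IJ colon I'E.
have [phi [hphi phi0 phiS]] := comparison_map hf hD rI hg hE rJ IJ.
have [genI exI0 exIS] := rI; have [genJ exJ0 exJS] := rJ.
have Df := resolves_aug0 rI; have Eg := resolves_aug0 rJ.
have DD i := resolves_bdry0 i rI; have EE i := resolves_bdry0 i rJ.
rewrite /= in genI exI0 exIS genJ exJ0 exJS Df Eg DD EE.
have scale_eq0 p (w : 'rV[S]_p) : x *: w = 0 -> w = 0.
  move=> xw0; apply/rowP => j; have /rowP/(_ j) := xw0; rewrite !mxE.
  by move/eqP; rewrite mulf_eq0 (negPf x0) => /eqP.
exists (cone_rank b c), (cone_aug x f g), (cone_bdry x D E phi); split.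
- move=> i j; rewrite /cone_aug ord1 mxE; case: split => k.
    by rewrite mxE; apply: (dhomogM hx (hg k 0)).
  by rewrite mxE; case: split => // -[].
- move=> i; apply: homogeneous_col_mx.
    by apply: homogeneous_row_mx => //; apply: homogeneous_mx0.
  apply: homogeneous_col_mx; apply: homogeneous_row_mx => //.
  + exact: homogeneous_mx0.
  + by apply: homogeneous_row_mx => //; apply: homogeneous_mx0.
  + exact: hphi.
  apply: homogeneous_row_mx => k l; rewrite mxE dhomogN.
    by rewrite mxE; case: eqP; rewrite ?mulr1n ?mulr0n ?dhomog0.
  by case: i k l => [|i] k l; [case: l | apply: hD].
split=> /= [p|y|i y].
- rewrite I'E; split=> [[q [r [/genJ[u ->] /genI[v ->] ->]]]|[y ->]].
    by exists (row_mx u (row_mx v 0)); rewrite mul_cone_aug !mxE.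
  have [u [v [w ->]]] := cone_row y; rewrite mul_cone_aug !mxE.
  exists ((u *m g) 0 0), ((v *m f) 0 0); split; rewrite ?mxE //.
    by apply/genJ; exists u; rewrite mxE.
  by apply/genI; exists v; rewrite mxE.
- split=> [|[z ->]]; last first.
    have [u [v [w ->]]] := cone_rowS z; rewrite mul_cone_bdry mul_cone_aug.
    rewrite mulmxDl mulmxBl -!mulmxA Eg Df phi0 !mulmx0 add0r sub0r -scalemxAl.
    by rewrite subrr.
  have [u [v [w ->]]] := cone_row y; rewrite mul_cone_aug => y0.
  have ugE : x *: (u *m g) = - v *m f.
    by rewrite mulNmx; apply/eqP; rewrite -addr_eq0 y0.
  have /colon/genI[w' w'00] : I (x * (u *m g) 0 0).
    by apply/genI; exists (- v); rewrite -ugE [RHS]mxE.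
  have w'E : u *m g = w' *m f by apply/matrixP => i j; rewrite !ord1.
  have [u' u'E] : exists u', u - w' *m phi 0%N = u' *m E 0%N.
    by apply/exJ0; rewrite mulmxBl -mulmxA phi0 w'E subrr.
  have [v' v'E] : exists v', v + x *: w' = v' *m D 0%N.
    by apply/exI0; rewrite mulmxDl -scalemxAl -w'E ugE mulNmx subrr.
  exists (row_mx u' (row_mx v' w')).
  rewrite mul_cone_bdry -u'E -v'E subrK addrK.
  by congr (row_mx _ (row_mx _ _)); rewrite !thinmx0.
split=> [|[z ->]]; last first.
  have [u [v [w ->]]] := cone_rowS z; rewrite !mul_cone_bdry.
  apply/row_mx3_eq0; split.
  - rewrite mulmxDl -!mulmxA EE phiS mulmx0 add0r mulNmx -mulmxA.
    by rewrite subrr.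
  - by rewrite mulmxBl -!mulmxA DD mulmx0 sub0r scalerN opprK -scalemxAl addNr.
  case: i {y} z u v w => [|i] z u v w /=; first by rewrite mulmx0 oppr0.
  by rewrite mulNmx opprK -mulmxA DD mulmx0.
have [u [v [w ->]]] := cone_rowS y; rewrite mul_cone_bdry => y0.
have [uw vw /eqP] := (row_mx3_eq0 _ _ _).1 y0; rewrite oppr_eq0 => /eqP w0.
(* For [i = 0] the condition on [w] is void, but [x w] is a boundary, so [f]
   vanishes on [x w] and hence on [w]. *)
have [w' w'E] : exists w', w = w' *m D i.
  case: i {y} u v w y0 uw vw w0 => [|i] u v w _ _ vw w0; last exact/exIS.
  apply/exI0/scale_eq0; rewrite scalemxAl -(subr0_eq vw) -mulmxA Df.
  exact: mulmx0.
have [v' v'E] : exists v', v - x *: w' = v' *m D i.+1.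
  by apply/exIS; rewrite mulmxBl -scalemxAl -w'E.
have [u' u'E] : exists u', u + w' *m phi i.+1 = u' *m E i.+1.
  by apply/exJS; rewrite mulmxDl -mulmxA phiS mulmxA -w'E.
exists (row_mx u' (row_mx v' (- w'))); rewrite mul_cone_bdry -u'E -v'E /=.
by rewrite !mulNmx addrK scalerN opprK subrK opprK -w'E.
Qed.

End Linear.

(** * Edge ideals of vertex splittable families *)


Section EdgeIdeals.
Local Open Scope ring_scope.
Variables (K : fieldType) (V : finType).
Local Notation S := {mpoly K[#|V|]}.
Local Notation m A := (@edge_monomial K V A).
Implicit Types (A B : {set V}) (C : {set {set V}}) (w : V).

Lemma edge_idealP C (p : S) :
  edge_ideal K C p <-> exists c : {set V} -> S, p = \sum_(A in C) c A * m A.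
Proof.
split=> [[c ->]|[c ->]].
  apply: (big_ind (fun q => exists c, q = \sum_(A in C) c A * m A)).
  - by exists (fun=> 0); rewrite big1 // => A _; rewrite mul0r.
  - move=> _ _ [c1 ->] [c2 ->]; exists (fun A => c1 A + c2 A).
    by rewrite -big_split; apply: eq_bigr => A _; rewrite mulrDl.
  move=> i _; have /imageP[A AC ->] := mem_nth 0 (ltn_ord i).
  exists (fun B => if B == A then c i else 0).
  rewrite (bigD1 A) //= eqxx big1 ?addr0 // => B /andP[_ /negPf->].
  by rewrite mul0r.
exists (fun i => c (nth set0 (enum C) i)); rewrite -big_enum /=.
rewrite (big_nth set0) big_mkord /edge_ideal size_map.
by apply: eq_bigr => i _; rewrite (nth_map set0).
Qed.

Lemma edge_idealD C p q :
  edge_ideal K C p -> edge_ideal K C q -> edge_ideal K C (p + q).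
Proof.
move=> /edge_idealP[c1 ->] /edge_idealP[c2 ->]; apply/edge_idealP.
exists (fun A => c1 A + c2 A).
by rewrite -big_split; apply: eq_bigr => A _; rewrite mulrDl.
Qed.

Lemma edge_idealM C p q : edge_ideal K C p -> edge_ideal K C (q * p).
Proof.
move=> /edge_idealP[c ->]; apply/edge_idealP; exists (fun A => q * c A).
by rewrite mulr_sumr; apply: eq_bigr => A _; rewrite mulrA.
Qed.

Lemma edge_ideal_mem C A : A \in C -> edge_ideal K C (m A).
Proof.
move=> AC; apply/edge_idealP; exists (fun B => (B == A)%:R).
rewrite (bigD1 A) //= eqxx mul1r big1 ?addr0 // => B /andP[_ /negPf->].
by rewrite mul0r.
Qed.

Lemma edge_monomialU1 w A : w \notin A ->
  m (w |: A) = 'X_(enum_rank w) * m A.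
Proof. by move=> wA; rewrite /edge_monomial big_setU1. Qed.

Lemma edge_monomial_sub A B : A \subset B -> m B = m (B :\: A) * m A.
Proof.
by move=> sAB; rewrite /edge_monomial (big_setID A) /= (setIidPr sAB) mulrC.
Qed.

Lemma edge_ideal_sub C C' p :
    (forall B, B \in C -> exists2 A, A \in C' & A \subset B) ->
  edge_ideal K C p -> edge_ideal K C' p.
Proof.
move=> CC' /edge_idealP[c ->].
apply: (big_ind (edge_ideal K C')).
- by apply/edge_idealP; exists (fun=> 0); rewrite big1 // => A _; rewrite mul0r.
- exact: edge_idealD.
move=> B /CC'[A AC' sAB]; rewrite (edge_monomial_sub sAB) mulrA.
exact/edge_idealM/edge_ideal_mem.
Qed.

(** Substituting [0] for the variable of [w] fixes the monomials not involving
    it; this separates the multiples of the variable in a membership. *)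
Definition set_var0 w : S -> S :=
  comp_mpoly [tuple if i == enum_rank w then 0 else 'X_i | i < #|V|].

Lemma set_var0M w : {morph set_var0 w : p q / p * q}.
Proof. by move=> p q; rewrite /set_var0 rmorphM. Qed.

Lemma set_var0_monomial w A : w \notin A -> set_var0 w (m A) = m A.
Proof.
move=> wA; rewrite /set_var0 /edge_monomial rmorph_prod; apply: eq_bigr => x xA.
rewrite /= comp_mpolyXU -tnth_nth tnth_mktuple.
case: eqP => // /enum_rank_inj xw.
by rewrite -xw xA in wA.
Qed.

Lemma set_var0_var w : set_var0 w 'X_(enum_rank w) = 0.
Proof. by rewrite /set_var0 comp_mpolyXU -tnth_nth tnth_mktuple eqxx. Qed.

Lemma set_var0_mod w (p : S) :
  exists q, p - set_var0 w p = 'X_(enum_rank w) * q.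
Proof.
pose P (p : S) := exists q, p - set_var0 w p = 'X_(enum_rank w) * q.
have PD p1 p2 : P p1 -> P p2 -> P (p1 + p2).
  move=> [q1 e1] [q2 e2]; exists (q1 + q2).
  by rewrite /set_var0 rmorphD /= opprD addrACA e1 e2 mulrDr.
have PM p1 p2 : P p1 -> P p2 -> P (p1 * p2).
  move=> [q1 e1] [q2 e2]; exists (q1 * p2 + set_var0 w p1 * q2).
  rewrite mulrDr mulrA -e1 mulrCA -e2 set_var0M.
  by rewrite mulrBl mulrBr addrA subrK.
have PC a : P a%:MP by exists 0; rewrite /set_var0 comp_mpolyC subrr mulr0.
have PX i : P 'X_i.
  rewrite /P /set_var0 comp_mpolyXU -tnth_nth tnth_mktuple.
  case: eqP => [->|_]; first by exists 1; rewrite subr0 mulr1.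
  by exists 0; rewrite subrr mulr0.
rewrite -/(P p) (mpolyE p); apply: (big_ind P) => //.
  by rewrite -mpolyC0.
move=> u _; rewrite -mul_mpolyC; apply: (PM) => //.
rewrite mpolyXE_id; apply: (big_ind P) => //; first by rewrite -mpolyC1.
move=> i _; elim: (u i) => [|k IHk]; first by rewrite expr0 -mpolyC1.
by rewrite exprS; apply: PM.
Qed.

Lemma mpolyX_neq0 i : ('X_i : S) != 0.
Proof. by rewrite -msupp_eq0 msuppX. Qed.

(** In [x p = sum of c_A m_A], the substitution [x = 0] shows that the parts of
    the coefficients free of [x] sum to zero, so each coefficient may be
    replaced by a multiple of [x], and [x] cancels. *)
Lemma edge_ideal_colon C w p : (forall A, A \in C -> w \notin A) ->
  edge_ideal K C ('X_(enum_rank w) * p) -> edge_ideal K C p.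
Proof.
move=> Cw /edge_idealP[c pE].
have sE : 0 = \sum_(A in C) set_var0 w (c A) * m A.
  have := congr1 (set_var0 w) pE; rewrite set_var0M set_var0_var mul0r.
  move=> sE0; apply: (etrans sE0); rewrite {1}/set_var0 rmorph_sum.
  apply: eq_bigr => A AC; rewrite /= -/(set_var0 w _) set_var0M.
  by rewrite [X in _ * X = _]set_var0_monomial // Cw.
have cE A := set_var0_mod w (c A).
have /fin_all_exists[q qE] := cE.
apply/edge_idealP; exists q; apply: (mulfI (mpolyX_neq0 (enum_rank w))).
rewrite pE -[LHS]subr0 [X in _ - X = _]sE -sumrB mulr_sumr.
by apply: eq_bigr => A _; rewrite -mulrBl qE mulrA.
Qed.

(** The edges containing [w] contribute the multiples of the variable of [w],
    by elements of the edge ideal of [C]. *)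
Lemma edge_ideal_split C C' w p :
    (forall A, A \in C -> w \notin A) -> (forall A, A \in C' -> w \notin A) ->
  edge_ideal K ([set w |: A | A : {set V} in C] :|: C') p <->
  exists q r, [/\ edge_ideal K C q, edge_ideal K C' r
                & p = 'X_(enum_rank w) * q + r].
Proof.
move=> Cw C'w.
have disj : [disjoint [set w |: A | A : {set V} in C] & C'].
  rewrite disjoint_subset; apply/subsetP => B /imsetP[A _ ->].
  by rewrite inE; apply: contraL (setU11 w A); apply: C'w.
have injw : {in C &, injective (fun A => w |: A)}.
  by move=> A B /Cw wA /Cw wB /= AB; rewrite -(setU1K wA) AB setU1K.
have sumE (c : {set V} -> S) :
    \sum_(B in [set w |: A | A : {set V} in C] :|: C') c B * m B =
    'X_(enum_rank w) * (\sum_(A in C) c (w |: A) * m A) +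
    \sum_(B in C') c B * m B.
  rewrite (eq_bigl _ _ (fun B => in_setU _ _ _)) bigU //=; congr (_ + _).
  rewrite big_imset //= mulr_sumr; apply: eq_bigr => A /Cw wA.
  by rewrite edge_monomialU1 // mulrCA.
split=> [/edge_idealP[c ->]|]; last first.
  move=> [q [r [/edge_idealP[c ->] /edge_idealP[c' ->] ->]]].
  apply/edge_idealP; exists (fun B => if w \in B then c (B :\ w) else c' B).
  rewrite sumE; congr (_ * _ + _); apply: eq_bigr => A.
    by move=> /Cw wA; rewrite setU11 setU1K.
  by move=> /C'w/negPf->.
rewrite sumE; eexists; eexists; split; last by [].
  by apply/edge_idealP; exists (fun A => c (w |: A)).
by apply/edge_idealP; exists c.
Qed.

Lemma vertex_splittable_linear k C : vertex_splittable k C ->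
  linearly_resolved k (edge_ideal K C).
Proof.
elim=> {k C} [k||k w C C' _ IHC _ IHC' Cw C'w sub].
- apply: linearly_resolved0 => p; rewrite edge_idealP.
  by split=> [[c ->]|->]; [|exists (fun=> 0)]; rewrite big_set0.
- apply: linearly_resolved1 => p; apply/edge_idealP; exists (fun=> p).
  by rewrite big_set1 /edge_monomial big_set0 mulr1.
apply: (linearly_resolved_cone (mpolyX_neq0 (enum_rank w)) _ IHC IHC').
- by rewrite dhomogX; apply/eqP/mdeg1.
- by move=> p; apply: edge_ideal_sub.
- by move=> p; apply: edge_ideal_colon.
by move=> p; apply: edge_ideal_split.
Qed.

End EdgeIdeals.

Theorem theorem3p2 (K : fieldType) (V : finType) (e : rel V)
    (e_sym : ssrbool.symmetric e) (e_irr : irreflexive e)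
    (e_block : block_graph e) (e_noiso : no_isolated_vertex e)
    (r : nat) (hr : 2 <= r) :
  has_linear_resolution
    (edge_ideal K (complement_clutter r.+1 (connected_clutter r e))).
Proof.
apply/(@linearly_resolved_linear _ _ r.+1)/vertex_splittable_linear.
have -> : complement_clutter r.+1 (connected_clutter r e) =
    ksubsets setT r.+1 (fun B => ~~ connected_transversal e set0 B).
  apply/setP => B; rewrite !inE subsetT /=; case: eqP => //= _.
  congr (~~ _); rewrite /connected_transversal.
  rewrite (_ : [forall _ in _, _]) ?andbT //.
  by apply/forall_inP => Q; rewrite inE.
apply: vertex_splittable_transversal => // [w p q|Q]; last by rewrite inE.
exact: block_graph_cut.
Qed.
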